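(* Let $\alpha,\beta\in\mathbb{R}$ and let $L:I\times\mathbb{R}^4\to\mathbb{R}$ satisfy: (H1) for every $t\in I$ the map $(u_0,u_1,u_2,u_3)\mapsto L(t,u_0,u_1,u_2,u_3)$ is in $C^1(\mathbb{R}^4,\mathbb{R})$; (H2) for every $y\in\mathcal{Y}^1$ the function $t\mapsto L\{y\}(t)$ is continuous at $\omega_0$; (H3) for every $y\in\mathcal{Y}^1$ and every $i\in\{2,3,4,5\}$ the function $t\mapsto\partial_iL\{y\}(t)$ belongs to $\mathcal{Y}^1$. Assume also that for all $y,h\in\mathcal{Y}^1$ the function $g(t,\varepsilon)=L\{y+\varepsilon h\}(t)$ ($|\varepsilon|<\bar\varepsilon$ for some $\bar\varepsilon>0$) satisfies: (i) $g(t,\cdot)$ is differentiable at $0$ uniformly in $t\in[a,b]_{q,\omega}$; (ii) $\int_{\omega_0}^ag(t,\varepsilon)\,d_{q,\omega}t$ and $\int_{\omega_0}^bg(t,\varepsilon)\,d_{q,\omega}t$ exist for all $\varepsilon$ sufficiently close to $0$; (iii) $\int_{\omega_0}^a\partial_2g(t,0)\,d_{q,\omega}t$ and $\int_{\omega_0}^b\partial_2g(t,0)\,d_{q,\omega}t$ exist, where $\partial_2g=\partial g/\partial\varepsilon$. If $\tilde y$ is a local minimizer or a local maximizer of $$\mathcal{L}[y]=\int_a^bL\big(t,y(qt+\omega),D_{q,\omega}[y](t),y(a),y(b)\big)\,d_{q,\omega}t$$ among the functions $y\in\mathcal{Y}^1$ with $y(a)=\alpha$ and $y(b)=\beta$,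 then $$\partial_2L\{\tilde y\}(t)-D_{q,\omega}\big[\partial_3L\{\tilde y\}\big](t)=0\qquad\text{for all }t\in[a,b]_{q,\omega}.$$
   Context: Let $q\in\,]0,1[$, $\omega\ge 0$, $\omega_0:=\omega/(1-q)$, let $I\subseteq\mathbb{R}$ be an interval containing $\omega_0$, and let $a,b\in I$ with $a<b$. Hahn difference operator: for $f:I\to\mathbb{R}$ differentiable at $\omega_0$, $D_{q,\omega}[f](t):=\frac{f(qt+\omega)-f(t)}{(q-1)t+\omega}$ if $t\ne\omega_0$, and $D_{q,\omega}[f](\omega_0):=f'(\omega_0)$ (ordinary derivative). $D^0_{q,\omega}[f]=f$ and $D^i_{q,\omega}$ is the $i$-fold iterate. $q,\omega$-integral: with $[k]_q:=\frac{1-q^k}{1-q}$, for $x\in I$, $\int_{\omega_0}^x f(t)\,d_{q,\omega}t:=(x(1-q)-\omega)\sum_{k=0}^{\infty}q^kf(xq^k+\omega[k]_q)$ (said to exist if the series converges), and $\int_a^b f\,d_{q,\omega}t:=\int_{\omega_0}^b f\,d_{q,\omega}t-\int_{\omega_0}^a f\,d_{q,\omega}t$. $[a,b]_{q,\omega}:=\{q^na+\omega[n]_q:n\in\mathbb{N}_0\}\cup\{q^nb+\omega[n]_q:n\in\mathbb{N}_0\}\cup\{\omega_0\}$. For $r\in\{0,1\}$, $\mathcal{Y}^r$ is the set of $y:I\to\mathbb{R}$ such that $D^i_{q,\omega}[y]$, $i=0,\dots,r$, are bounded on $[a,b]$ and continuous at $\omega_0$, with $\|y\|_{r,\infty}:=\sum_{i=0}^r\|D^i_{q,\omega}[y]\|_\infty$,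 $\|y\|_\infty:=\sup_{t\in[a,b]}|y(t)|$. $\partial_iL$ is the partial derivative of $L$ with respect to its $i$th argument ($t$ being the first). For $y\in\mathcal{Y}^1$, $\{y\}(t):=(t,y(qt+\omega),D_{q,\omega}[y](t),y(a),y(b))$, $L\{y\}(t):=L(\{y\}(t))$, $\partial_iL\{y\}(t):=(\partial_iL)(\{y\}(t))$; $D_{q,\omega}[\partial_3L\{y\}]$ is the Hahn derivative of the function $t\mapsto\partial_3L\{y\}(t)$. Uniform differentiability: $g(t,\cdot)$ is differentiable at $0$ uniformly in $t\in[a,b]_{q,\omega}$ if for every $\eta>0$ there is $\delta>0$ such that $0<|\varepsilon|<\delta$ implies $\left|\frac{g(t,\varepsilon)-g(t,0)}{\varepsilon}-\partial_2g(t,0)\right|<\eta$ for all $t\in[a,b]_{q,\omega}$. $\tilde y$ is a local minimizer (resp. maximizer) if $\tilde y\in\mathcal{Y}^1$ satisfies $\tilde y(a)=\alpha$, $\tilde y(b)=\beta$ and there is $\delta>0$ with $\mathcal{L}[\tilde y]\le\mathcal{L}[y]$ (resp. $\ge$) for all $y\in\mathcal{Y}^1$ with $y(a)=\alpha$, $y(b)=\beta$ and $\|\tilde y-y\|_{1,\infty}<\delta$.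
   Formalization: The formal theorem adds the hypothesis that q^m a+ω[m]_q ≠ q^n b+ω[n]_q for all m,n∈ℕ₀ (automatic if ω₀∈[a,b]); without it the claim is false, e.g. q=1/2, ω=0, a=1/2, b=1, L=u_0. *)

(* Defs.v *)
From HB Require Import structures.
From mathcomp Require Import all_boot all_order all_algebra.
From mathcomp Require Import all_classical all_reals all_analysis.

Set Implicit Arguments.
Unset Strict Implicit.
Unset Printing Implicit Defensive.

Import Order.TTheory GRing.Theory Num.Theory.
Import numFieldNormedType.Exports.

Local Open Scope classical_set_scope.
Local Open Scope ring_scope.

(* A function on the interval I is a total function R -> R of which only the
   values on I are ever inspected: limits at omega_0 are taken within I, so
   they are one-sided when omega_0 is an end point of I. *)

Definition omega0 (R : realType) (q w : R) : R := w / (1 - q).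

Definition qnum (R : realType) (q : R) (k : nat) : R :=
  (1 - q ^+ k) / (1 - q).

Definition qw_iter (R : realType) (q w : R) (n : nat) (x : R) : R :=
  q ^+ n * x + w * qnum q n.

Definition qw_interval (R : realType) (q w a b : R) : set R :=
  [set t | exists n : nat, t = qw_iter q w n a] `|`
  [set t | exists n : nat, t = qw_iter q w n b] `|`
  [set omega0 q w].

(* This holds when omega_0 is in [a, b], and otherwise excludes only the case
   where one of a, b is an iterate of the other.  In that case the tails of the
   two series defining the integral from a to b cancel, the functional does not
   see the Lagrangian at the remaining points of [qw_interval], and the
   Euler-Lagrange equation fails there: e.g. q = 1/2, omega = 0, a = 1/2, b = 1
   and L = u_0, whose integral is y(a) / 2. *)
Definition disjoint_orbits (R : realType) (q w a b : R) :=
  forall m n : nat, qw_iter q w m a <> qw_iter q w n b.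

Definition diff_quot (R : realType) (f : R -> R) (x t : R) : R :=
  (f t - f x) / (t - x).

Definition derivable_within (R : realType) (I : set R) (f : R -> R) (x : R) :=
  cvg (diff_quot f x t @[t --> within I x^']).

Definition derive_within (R : realType) (I : set R) (f : R -> R) (x : R) : R :=
  lim (diff_quot f x t @[t --> within I x^']).

Definition continuous_within (R : realType) (I : set R) (f : R -> R) (x : R) :=
  f t @[t --> within I (nbhs x)] --> f x.

Definition hahn (R : realType) (q w : R) (I : set R) (f : R -> R) (t : R) : R :=
  if t == omega0 q w then derive_within I f (omega0 q w)
  else (f (q * t + w) - f t) / ((q - 1) * t + w).

Definition qw_series (R : realType) (q w x : R) (f : R -> R) : nat -> R :=
  series (fun k => q ^+ k * f (x * q ^+ k + w * qnum q k)).

Definition qw_integrable (R : realType) (q w x : R) (f : R -> R) :=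
  cvgn (qw_series q w x f).

Definition qw_integral0 (R : realType) (q w x : R) (f : R -> R) : R :=
  (x * (1 - q) - w) * limn (qw_series q w x f).

Definition qw_integral (R : realType) (q w a b : R) (f : R -> R) : R :=
  qw_integral0 q w b f - qw_integral0 q w a f.

(* Differentiability at omega_0 is what makes the next iterate of the Hahn
   operator defined there; in [hahn] the limit is a total operator. *)
Definition spaceY (R : realType) (q w : R) (I : set R) (a b : R) (r : nat) :
    set (R -> R) :=
  [set y | (forall i : nat, (i < r)%N ->
              derivable_within I (iter i (hahn q w I) y) (omega0 q w)) /\
           (forall i : nat, (i <= r)%N ->
              [bounded (iter i (hahn q w I) y t : R^o) | t in `[a, b]] /\
              continuous_within I (iter i (hahn q w I) y) (omega0 q w))].

Definition supnorm (R : realType) (a b : R) (y : R -> R) : R :=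
  sup [set `|y t| | t in `[a, b]].

Definition normY (R : realType) (q w : R) (I : set R) (a b : R) (r : nat)
    (y : R -> R) : R :=
  \sum_(i < r.+1) supnorm a b (iter i (hahn q w I) y).

(* A Lagrangian L(t, u_0, u_1, u_2, u_3) is written [L t u] with u a row of
   R^4; coordinate j : 'I_4 of u is the argument of L number j + 2. *)

Definition partialC (R : realType) (j : 'I_4) (F : 'rV[R]_4 -> R)
    (u : 'rV[R]_4) : R :=
  'D_(delta_mx 0 j) F u.

Definition classC1 (R : realType) (F : 'rV[R]_4 -> R) :=
  forall j : 'I_4, (forall u, derivable F u (delta_mx 0 j)) /\
                   continuous (partialC j F : 'rV[R]_4 -> R).

Definition dL (R : realType) (L : R -> 'rV[R]_4 -> R) (j : 'I_4) :
    R -> 'rV[R]_4 -> R :=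
  fun t => partialC j (L t).

Definition curly (R : realType) (q w : R) (I : set R) (a b : R) (y : R -> R)
    (t : R) : 'rV[R]_4 :=
  \row_(j < 4) [:: y (q * t + w); hahn q w I y t; y a; y b]`_j.

Definition along (R : realType) (q w : R) (I : set R) (a b : R)
    (L : R -> 'rV[R]_4 -> R) (y : R -> R) (t : R) : R :=
  L t (curly q w I a b y t).

Definition functional (R : realType) (q w : R) (I : set R) (a b : R)
    (L : R -> 'rV[R]_4 -> R) (y : R -> R) : R :=
  qw_integral q w a b (along q w I a b L y).

Definition var_along (R : realType) (q w : R) (I : set R) (a b : R)
    (L : R -> 'rV[R]_4 -> R) (y h : R -> R) (t e : R) : R :=
  along q w I a b L (fun s => y s + e * h s) t.

Definition unif_derivable0 (R : realType) (S : set R) (g : R -> R -> R) :=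
  (forall t, S t -> derivable (g t) 0 1) /\
  forall eta : R, 0 < eta -> exists2 delta : R, 0 < delta &
    forall e : R, 0 < `|e| < delta -> forall t, S t ->
      `|(g t e - g t 0) / e - derive1 (g t) 0| < eta.

Definition admissible (R : realType) (q w : R) (I : set R)
    (a b alpha beta : R) : set (R -> R) :=
  [set y | spaceY q w I a b 1 y /\ y a = alpha /\ y b = beta].

Definition local_minimizer (R : realType) (q w : R) (I : set R)
    (a b alpha beta : R) (J : (R -> R) -> R) (y0 : R -> R) :=
  admissible q w I a b alpha beta y0 /\
  exists2 delta : R, 0 < delta &
    forall y, admissible q w I a b alpha beta y ->
      normY q w I a b 1 (y0 \- y) < delta -> J y0 <= J y.

Definition local_maximizer (R : realType) (q w : R) (I : set R)
    (a b alpha beta : R) (J : (R -> R) -> R) (y0 : R -> R) :=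
  admissible q w I a b alpha beta y0 /\
  exists2 delta : R, 0 < delta &
    forall y, admissible q w I a b alpha beta y ->
      normY q w I a b 1 (y0 \- y) < delta -> J y <= J y0.

(* Main.v *)
Require Import Defs.
From mathcomp Require Import all_boot all_order all_algebra.
From mathcomp Require Import all_classical all_reals all_analysis.
From mathcomp Require Import ring lra.
Set Implicit Arguments.
Unset Strict Implicit.
Unset Printing Implicit Defensive.

Import Order.TTheory GRing.Theory Num.Theory.
Import numFieldNormedType.Exports.
Local Open Scope classical_set_scope.
Local Open Scope ring_scope.

(** The Euler-Lagrange equation is obtained by varying the extremizer y in the
    direction of a point mass.  Let s(t) = q t + w, whose fixed point is
    omega_0, and let x be one of a, b, different from omega_0.  The orbit
    s^n(x) tends to omega_0 without meeting it, so for t = s^n(x) the function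
    h equal to 1 at s(t) and to 0 elsewhere vanishes near omega_0.  Hence h is
    in Y^1, its Hahn derivative lives on the two points t and s(t) only
    ([hahn_point_mass]), and h(a) = h(b) = 0: the orbit of x does not return to
    x, and it is disjoint from that of the other end point.

    With this h, the integrands of L[y + e h] and L[y] differ at only two terms
    of the series of x and at no term of the other series
    ([qw_integral0_subr_two], [qw_integral0_eq]).  So L[y + e h] - L[y] is, for
    small e, a combination of the increments of the Lagrangian at the times t
    and s(t), each along a line of R^4: no limit is interchanged with a
    derivative, and the chain rule ([is_derive_var_along0]) gives the
    derivative at e = 0.  Writing
    m = (q - 1) t + w for the step s(t) - t, the step at s(t) is q m, and that
    derivative is a nonzero multiple of
      q^n (d_2 L(t) + d_3 L(t) / m) - q^(n+1) d_3 L(s(t)) / (q m)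
        = q^n (d_2 L - D[d_3 L])(t).
    It vanishes by Fermat's rule, which is the equation at t
    ([Euler_Lagrange_orbit]).  At omega_0 the equation follows by letting t run
    along such an orbit, since d_2 L{y} and D[d_3 L{y}] are continuous there. *)

(** * Directional derivatives of functions with continuous partials *)

Lemma derivable_along_line (R : numFieldType) (V W : normedModType R)
    (F : V -> W) (u d : V) (s : R) :
  derivable F (u + s *: d) d ->
  is_derive s 1 (fun r => F (u + r *: d)) ('D_d F (u + s *: d)).
Proof.
have E : (fun h : R => h^-1 *: (((fun r => F (u + r *: d)) \o shift s) (h *: 1)
      - F (u + s *: d))) =
    (fun h => h^-1 *: ((F \o shift (u + s *: d)) (h *: d) - F (u + s *: d))).
  by apply/funext => h /=; rewrite [h%:A]mulr1 scalerDl addrCA.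
by move=> dF; split; rewrite /derivable /derive E.
Qed.

Lemma MVT_along_line (R : realType) (V : normedModType R) (F : V -> R)
    (u d : V) (c : R) :
  (forall x, derivable F x d) ->
  exists2 s, `|s| <= `|c| & F (u + c *: d) - F u = 'D_d F (u + s *: d) * c.
Proof.
move=> dF; pose f (r : R) := F (u + r *: d).
have D (r : R) : is_derive r 1 f ('D_d F (u + r *: d)).
  exact: derivable_along_line.
have f_cont (i : interval R) : {within [set` i], continuous f}.
  by apply: derivable_within_continuous => r _; exact: ex_derive.
have -> : F u = f 0 by rewrite /f scale0r addr0.
have [c0|/ltW c0] := leP 0 c.
  have [s + E] := MVT_segment c0 (fun r _ => D r) (f_cont _).
  rewrite in_itv /= => /andP[s0 sc]; exists s; last by rewrite E subr0.
  by rewrite !ger0_norm.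
have [s + E] := MVT_segment c0 (fun r _ => D r) (f_cont _).
rewrite in_itv /= => /andP[s0 sc]; exists s.
  by rewrite !ler0_norm// lerN2.
by rewrite -opprB E sub0r mulrN opprK.
Qed.

(** Along u + h (v + p d), the increment of F splits into the increment along
    h v and an increment along h p d; by the mean value theorem the latter is
    h p times a value of D_d F at a point tending to u, and continuity of D_d F
    at u gives its limit.  Adding one direction at a time this way gives the
    chain rule for functions of class C^1 without total differentiability. *)
Lemma is_derive_dirD (R : realType) (V : normedModType R) (F : V -> R)
    (u v d : V) (l p : R) :
  is_derive u v F l -> (forall x, derivable F x d) ->
  {for u, continuous ('D_d F : V -> R)} ->
  is_derive u (v + p *: d) F (l + p * 'D_d F u).
Proof.
move=> [dv Dv] dd cont_d.
pose Q (h : R) : R :=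
  h^-1 * (F (u + h *: v + (h * p) *: d) - F (u + h *: v)).
suff QP : Q h @[h --> 0^'] --> p * 'D_d F u.
  have E : (fun h : R => h^-1 *: ((F \o shift u) (h *: (v + p *: d)) - F u)) =
      (fun h => h^-1 *: ((F \o shift u) (h *: v) - F u)) \+ Q.
    apply/funext => h /=; rewrite /Q [h *: (v + _)]scalerDr scalerA addrAC.
    rewrite [h *: v + u]addrC -[LHS]/(h^-1 * _) -[X in _ = X + _]/(h^-1 * _).
    by rewrite -mulrDr; congr (_ * _); rewrite [RHS]addrC subrKA.
  have H : h^-1 *: ((F \o shift u) (h *: (v + p *: d)) - F u) @[h --> 0^'] -->
      l + p * 'D_d F u.
    by rewrite E; apply: cvgD => //; rewrite -Dv; exact: dv.
  split; first by apply/cvg_ex; eexists; exact: H.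
  exact: (cvg_lim (@Rhausdorff R) H).
apply/cvgrPdist_lt => e e0.
have e'0 : 0 < e / (`|p| + 1) by rewrite divr_gt0// ltr_wpDl.
move/cvgrPdist_lt: cont_d => /(_ _ e'0)/nbhs_ballP[r /= r0 Hr].
near=> h; rewrite /Q.
have h0 : h != 0 by near: h; exact: nbhs_dnbhs_neq.
have [s sh ->] := MVT_along_line (u + h *: v) (h * p) dd.
have -> : h^-1 * ('D_d F (u + h *: v + s *: d) * (h * p)) =
    p * 'D_d F (u + h *: v + s *: d).
  by rewrite [_ * (h * p)]mulrC mulrA mulrA mulVf// mul1r.
rewrite -mulrBr normrM.
have lt_D : `|'D_d F u - 'D_d F (u + h *: v + s *: d)| < e / (`|p| + 1).
  apply: Hr; rewrite -ball_normE /ball_ /= -addrA opprD addrA subrr.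
  rewrite sub0r normrN.
  apply: le_lt_trans (ler_normD _ _) _; rewrite !normrZ.
  apply: (@le_lt_trans _ _ (`|h| * (`|v| + `|p| * `|d|))).
    by rewrite mulrDr lerD2l mulrA -normrM ler_wpM2r.
  have hr : `|h| < r / (`|v| + `|p| * `|d| + 1).
    near: h; apply: dnbhs0_lt.
    by rewrite divr_gt0// ltr_wpDl// addr_ge0// mulr_ge0.
  move: hr; rewrite ltr_pdivlMr; last by rewrite ltr_wpDl// addr_ge0// mulr_ge0.
  by apply: le_lt_trans; rewrite ler_wpM2l// lerDl.
apply: le_lt_trans (_ : `|p| * (e / (`|p| + 1)) < e).
  by rewrite ler_wpM2l// ltW.
by rewrite mulrA ltr_pdivrMr ?ltr_wpDl// mulrC ltr_pM2l// ltrDl.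
Unshelve. all: by end_near.
Qed.

Lemma is_derive_dir0 (R : numFieldType) (V W : normedModType R) (F : V -> W)
    (u : V) : is_derive u 0 F 0.
Proof.
have E : (fun h : R => h^-1 *: ((F \o shift u) (h *: 0) - F u)) = cst 0.
  by apply/funext => h /=; rewrite scaler0 add0r subrr scaler0.
split; rewrite /derivable /derive E; first exact: is_cvg_cst.
exact: lim_cst.
Qed.

Lemma classC1_is_derive2 (R : realType) (F : 'rV[R]_4 -> R) (u : 'rV[R]_4)
    (i j : 'I_4) (r s : R) :
  classC1 F ->
  is_derive u (r *: delta_mx 0 i + s *: delta_mx 0 j) F
    (r * partialC i F u + s * partialC j F u).
Proof.
move=> FC1; have [di ci] := FC1 i; have [dj cj] := FC1 j.
apply: is_derive_dirD => //; last exact: cj.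
rewrite -[_ *: _]add0r -[_ * _]add0r.
apply: is_derive_dirD => //; last exact: ci.
exact: is_derive_dir0.
Qed.

(** * Orbits of t |-> q t + w *)

Section Orbits.
Context (R : realType) (q w : R).
Hypothesis hq : 0 < q < 1.

Let q0 : 0 < q. Proof. by case/andP: hq. Qed.
Let q1 : q < 1. Proof. by case/andP: hq. Qed.
Let q1N0 : 1 - q != 0. Proof. by rewrite subr_eq0 gt_eqF. Qed.
Local Notation om := (omega0 q w).

Lemma hahn_denomE t : (q - 1) * t + w = (q - 1) * (t - om).
Proof. by rewrite /omega0; field. Qed.

Lemma hahn_denom_eq0 t : ((q - 1) * t + w == 0) = (t == om).
Proof.
by rewrite hahn_denomE mulf_eq0 subr_eq0 lt_eqF// subr_eq0.
Qed.

Lemma qw_iterE n x : qw_iter q w n x = om + q ^+ n * (x - om).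
Proof. by rewrite /qw_iter /qnum /omega0; field. Qed.

Lemma qw_iter0 x : qw_iter q w 0 x = x.
Proof. by rewrite qw_iterE expr0 mul1r addrC subrK. Qed.

Lemma qw_iterS n x : qw_iter q w n.+1 x = q * qw_iter q w n x + w.
Proof. by rewrite !qw_iterE exprS /omega0; field. Qed.

Lemma qw_iter_eq_omega0 n x : (qw_iter q w n x == om) = (x == om).
Proof.
rewrite qw_iterE -[X in _ == X]addr0 (inj_eq (addrI _)) mulf_eq0 subr_eq0.
by rewrite expf_eq0 gt_eqF// andbF.
Qed.

Lemma qw_iter_inj x : x != om -> injective (fun n => qw_iter q w n x).
Proof.
move=> xom m n; rewrite !qw_iterE => /addrI/mulIf; rewrite subr_eq0 => /(_ xom).
by apply: ieexprIn => //; rewrite lt_eqF.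
Qed.

Lemma qw_iter_cvg x : qw_iter q w n x @[n --> \oo] --> om.
Proof.
under eq_fun do rewrite qw_iterE.
suff : om + q ^+ n * (x - om) @[n --> \oo] --> om + 0 * (x - om).
  by rewrite mul0r addr0.
apply: cvgD; first exact: cvg_cst.
apply: cvgM; last exact: cvg_cst.
by apply: cvg_expr; rewrite gtr0_norm.
Qed.

Section Interval.
Context (I : set R).
Hypotheses (hI : is_interval I) (hI0 : I om).

Lemma qw_iter_in n x : I x -> I (qw_iter q w n x).
Proof.
move=> Ix; rewrite qw_iterE.
have qn0 : 0 <= q ^+ n by rewrite exprn_ge0// ltW.
have qn1 : q ^+ n <= 1 by rewrite exprn_ile1// ltW.
have [omx|/ltW xom] := leP om x.
  by apply: (hI hI0 Ix); apply/andP; split; nra.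
by apply: (hI Ix hI0); apply/andP; split; nra.
Qed.

Lemma qw_iter_cvg_within x : I x ->
  qw_iter q w n x @[n --> \oo] --> within I (nbhs om).
Proof.
move=> Ix A A_om; have [N _ An] := qw_iter_cvg x A_om.
by exists N => // n /An; apply; exact: qw_iter_in.
Qed.

Lemma qw_iter_cvg_within_dnbhs x : I x -> x != om ->
  qw_iter q w n x @[n --> \oo] --> within I om^'.
Proof.
move=> Ix xom A A_om; have [N _ An] := qw_iter_cvg x A_om.
exists N => // n /An; apply; first by rewrite /= qw_iter_eq_omega0.
exact: qw_iter_in.
Qed.

(** Limits at omega_0 within I are unique: an orbit in I accumulates there. *)
Lemma within_dnbhs_omega0_proper x : I x -> x != om ->
  ProperFilter (within I om^').
Proof.
move=> Ix xom; apply: Build_ProperFilter => om_set0.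
by have /filter_ex[] := qw_iter_cvg_within_dnbhs Ix xom om_set0.
Qed.

End Interval.
End Orbits.

(** * Linearity of the Hahn operator and of the space Y^1 *)

Lemma bounded_onP (R : realType) (A : set R) (f : R -> R) :
  [bounded (f t : R^o) | t in A] <-> exists M, forall t, A t -> `|f t| <= M.
Proof.
split=> [/ex_strict_bound_gt0[M _ fM]|[M fM]].
  by exists M => t /fM/ltW.
exists M; split; first exact: num_real.
by move=> r Mr t /fM /le_trans; apply; exact: ltW.
Qed.

Section HahnLinear.
Context (R : realType) (q w : R) (I : set R).
Local Notation om := (omega0 q w).
Context (PF : ProperFilter (within I om^')).

Lemma derive_withinD (f g : R -> R) :
  derivable_within I f om -> derivable_within I g om ->
  derivable_within I (fun t => f t + g t) om /\
  derive_within I (fun t => f t + g t) om =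
    derive_within I f om + derive_within I g om.
Proof.
move=> df dg; rewrite /derivable_within /derive_within.
have -> : diff_quot (fun t => f t + g t) om =
    (fun t => diff_quot f om t + diff_quot g om t).
  by apply/funext => t; rewrite /diff_quot -mulrDl; congr (_ / _); ring.
by split; [exact: is_cvgD|exact: limD].
Qed.

Lemma derive_withinZ (c : R) (f : R -> R) :
  derivable_within I f om ->
  derivable_within I (fun t => c * f t) om /\
  derive_within I (fun t => c * f t) om = c * derive_within I f om.
Proof.
move=> df; rewrite /derivable_within /derive_within.
have -> : diff_quot (fun t => c * f t) om = (fun t => c * diff_quot f om t).
  by apply/funext => t; rewrite /diff_quot mulrA; congr (_ / _); ring.
split; first by apply: is_cvgM => //; exact: is_cvg_cst.
by apply: cvg_lim => //; apply: cvgM df; exact: cvg_cst.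
Qed.

Lemma hahnD (f g : R -> R) :
  derivable_within I f om -> derivable_within I g om ->
  hahn q w I (fun t => f t + g t) = (fun t => hahn q w I f t + hahn q w I g t).
Proof.
move=> df dg; apply/funext => t; rewrite /hahn; case: eqVneq => _.
  by have [] := derive_withinD df dg.
by rewrite -mulrDl; congr (_ / _); ring.
Qed.

Lemma hahnZ (c : R) (f : R -> R) :
  derivable_within I f om ->
  hahn q w I (fun t => c * f t) = (fun t => c * hahn q w I f t).
Proof.
move=> df; apply/funext => t; rewrite /hahn; case: eqVneq => _.
  by have [] := derive_withinZ c df.
by rewrite mulrA; congr (_ / _); ring.
Qed.

Context (a b : R).

Lemma spaceY1P (f : R -> R) : spaceY q w I a b 1 f <->
  [/\ derivable_within I f om,
      [bounded (f t : R^o) | t in `[a, b]] /\ continuous_within I f om &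
      [bounded (hahn q w I f t : R^o) | t in `[a, b]] /\
      continuous_within I (hahn q w I f) om].
Proof.
split=> [[df cf]|[df f0 f1]].
  by split; [exact: (df 0)|exact: (cf 0)|exact: (cf 1)].
by split=> -[|[|i]].
Qed.

Lemma spaceY1D (f g : R -> R) :
  spaceY q w I a b 1 f -> spaceY q w I a b 1 g ->
  spaceY q w I a b 1 (fun t => f t + g t).
Proof.
move=> /spaceY1P[df [bf cf] [bDf cDf]] /spaceY1P[dg [bg cg] [bDg cDg]].
have bD (u v : R -> R) : [bounded (u t : R^o) | t in `[a, b]] ->
    [bounded (v t : R^o) | t in `[a, b]] ->
    [bounded (u t + v t : R^o) | t in `[a, b]].
  move=> /bounded_onP[M uM] /bounded_onP[N vN]; apply/bounded_onP.
  exists (M + N) => t tab; apply: le_trans (ler_normD _ _) _.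
  by rewrite lerD ?uM ?vN.
apply/spaceY1P; rewrite hahnD//; split.
- by have [] := derive_withinD df dg.
- by split; [exact: bD|exact: cvgD].
- by split; [exact: bD|exact: cvgD].
Qed.

Lemma spaceY1Z (c : R) (f : R -> R) :
  spaceY q w I a b 1 f -> spaceY q w I a b 1 (fun t => c * f t).
Proof.
move=> /spaceY1P[df [bf cf] [bDf cDf]].
have bZ (g : R -> R) : [bounded (g t : R^o) | t in `[a, b]] ->
    [bounded (c * g t : R^o) | t in `[a, b]].
  move=> /bounded_onP[M gM]; apply/bounded_onP; exists (`|c| * M) => t /gM.
  by rewrite /= normrM => gt; rewrite ler_wpM2l.
apply/spaceY1P; rewrite hahnZ//; split; first by have [] := derive_withinZ c df.
- by split; [exact: bZ|apply: cvgM => //; exact: cvg_cst].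
- by split; [exact: bZ|apply: cvgM => //; exact: cvg_cst].
Qed.

Hypothesis ab : a <= b.

Lemma supnormZ_le (c : R) (f : R -> R) :
  [bounded (f t : R^o) | t in `[a, b]] ->
  supnorm a b (fun t => c * f t) <= `|c| * supnorm a b f.
Proof.
move=> /bounded_onP[M fM]; apply: ge_sup.
  by exists `|c * f a|; exists a => //=; rewrite in_itv /= lexx.
move=> _ [t tab <-]; rewrite normrM ler_wpM2l//.
apply: ub_le_sup; last by exists t.
by exists M => _ [s /fM ? <-].
Qed.

Lemma normYZ_le (c : R) (f : R -> R) : spaceY q w I a b 1 f ->
  normY q w I a b 1 (fun t => c * f t) <= `|c| * normY q w I a b 1 f.
Proof.
move=> /spaceY1P[df [bf _] [bDf _]]; rewrite /normY !big_ord_recl !big_ord0 /=.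
by rewrite hahnZ// !addr0 mulrDr lerD// supnormZ_le.
Qed.

End HahnLinear.

(** * Point masses as variations *)

Definition point_mass (R : realType) (z t : R) : R := (t == z)%:R.

Lemma near_point_mass0 (R : realType) (c z : R) : c != z ->
  \forall t \near c, point_mass z t = 0.
Proof.
move=> cz; near=> t.
suff /negbTE tz : t != z by rewrite /point_mass tz.
near: t; apply/nbhs_ballP; exists `|c - z|.
  by rewrite /= normr_gt0 subr_eq0.
move=> t ct; apply/eqP => tz; move: ct.
by rewrite tz -ball_normE /ball_ /= ltxx.
Unshelve. all: by end_near.
Qed.

Section PointMass.
Context (R : realType) (q w : R) (I : set R) (a b : R).
Hypothesis hq : 0 < q < 1.
Local Notation om := (omega0 q w).
Context (PF : ProperFilter (within I om^')).

Lemma point_mass_derive0 z : z != om ->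
  derivable_within I (point_mass z) om /\
  derive_within I (point_mass z) om = 0.
Proof.
move=> zom; rewrite /derivable_within /derive_within.
suff H : diff_quot (point_mass z) om t @[t --> within I om^'] --> 0.
  by split; [apply/cvg_ex; exists 0|exact: cvg_lim H].
apply: cvg_near_cst.
have Ez : point_mass z om = 0 by rewrite /point_mass eq_sym (negbTE zom).
have := near_point_mass0 (R := R) (c := om) (z := z).
rewrite eq_sym zom => /(_ isT) H.
apply: cvg_within; apply: nbhs_dnbhs; apply: filterS H => t Et.
by rewrite /diff_quot Et Ez subrr mul0r.
Qed.

Context (x : R).
Hypothesis xom : x != om.
Let z := q * x + w.

Let zom : z != om.
Proof. by rewrite /z -[x](qw_iter0 w hq) -qw_iterS// qw_iter_eq_omega0. Qed.

(** Only t = x and t = z contribute to the difference quotient, since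
    q t + w = z exactly when t = x; at omega_0 the derivative is 0 because the
    point mass vanishes nearby. *)
Lemma hahn_point_mass :
  hahn q w I (point_mass z) =
  fun t => point_mass x t / ((q - 1) * x + w)
           - point_mass z t / ((q - 1) * z + w).
Proof.
apply/funext => t; rewrite /hahn; case: eqVneq => [->|tom].
  have [_ ->] := point_mass_derive0 zom.
  rewrite /point_mass ![om == _]eq_sym (negbTE xom) (negbTE zom).
  by rewrite !mul0r subrr.
have q0 : q != 0 by rewrite gt_eqF//; case/andP: hq.
have -> : point_mass z (q * t + w) = point_mass x t.
  by rewrite /point_mass /z (inj_eq (addIr _)) (inj_eq (mulfI q0)).
rewrite mulrBl /point_mass; congr (_ - _).
- by case: eqVneq => [->//|]; rewrite !mul0r.
- by case: eqVneq => [->//|]; rewrite !mul0r.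
Qed.

Lemma spaceY_point_mass : spaceY q w I a b 1 (point_mass z).
Proof.
have pm1 y t : `|point_mass y t : R| <= 1.
  by rewrite /point_mass; case: eqP; rewrite ?normr0 ?normr1.
have pm_cvg y : y != om ->
    point_mass y t @[t --> within I (nbhs om)] --> point_mass y om.
  rewrite eq_sym => omy; rewrite [X in _ --> X]/point_mass (negbTE omy).
  apply: cvg_within_filter; apply: cvg_near_cst; exact: near_point_mass0.
apply/spaceY1P; split; first by have [] := point_mass_derive0 zom.
- by split; [apply/bounded_onP; exists 1|exact: pm_cvg].
- rewrite hahn_point_mass; split.
    apply/bounded_onP.
    exists (`|((q - 1) * x + w)^-1| + `|((q - 1) * z + w)^-1|) => t _.
    by apply: le_trans (ler_normB _ _) _; rewrite !normrM lerD// ler_piMl.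
  by apply: cvgB; apply: cvgM; try exact: cvg_cst; exact: pm_cvg.
Qed.

End PointMass.

(** * Finite changes in the Jackson-type series *)

Lemma lim_series_subr_two (R : realType) (u v : nat -> R) (n : nat) :
  cvgn (series u) -> cvgn (series v) ->
  (forall k, k != n -> k != n.+1 -> u k = v k) ->
  limn (series u) - limn (series v) = (u n - v n) + (u n.+1 - v n.+1).
Proof.
move=> cu cv uv; rewrite -limB//; apply: lim_near_cst => //.
exists n.+2 => // N /= nN.
rewrite [LHS](_ : _ = \sum_(0 <= k < N) (u k - v k)); last by rewrite sumrB.
rewrite (big_cat_nat (n := n.+2))//= big_nat_recr//= big_nat_recr//=.
rewrite big_nat big1 ?add0r => [|k /andP[_ kn]]; last first.
  by rewrite uv ?subrr// ltn_eqF// ltnW.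
rewrite [X in _ + X]big_nat big1 ?addr0// => k /andP[nk _].
by rewrite uv ?subrr// gtn_eqF// ltnW.
Qed.

Section IntegralChange.
Context (R : realType) (q w : R) (f g : R -> R).

Lemma qw_integral0_eq x :
  (forall k, f (qw_iter q w k x) = g (qw_iter q w k x)) ->
  qw_integral0 q w x f = qw_integral0 q w x g.
Proof.
move=> fg; rewrite /qw_integral0.
suff -> : qw_series q w x f = qw_series q w x g by [].
by congr series; apply/funext => k; rewrite [x * _]mulrC [f _]fg.
Qed.

Lemma qw_integral0_subr_two x n :
  qw_integrable q w x f -> qw_integrable q w x g ->
  (forall k, k != n -> k != n.+1 ->
     f (qw_iter q w k x) = g (qw_iter q w k x)) ->
  qw_integral0 q w x f - qw_integral0 q w x g =
  (x * (1 - q) - w) *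
    (q ^+ n * (f (qw_iter q w n x) - g (qw_iter q w n x)) +
     q ^+ n.+1 * (f (qw_iter q w n.+1 x) - g (qw_iter q w n.+1 x))).
Proof.
move=> fi gi fg; rewrite /qw_integral0 -mulrBr; congr (_ * _).
rewrite (lim_series_subr_two (n := n))//.
  by rewrite ![x * _]mulrC -!mulrBr.
by move=> k kn kn1; rewrite [x * _]mulrC [f _]fg.
Qed.

End IntegralChange.

(** * First variation in a direction vanishing at the end points *)

Lemma local_extremum_derive0 (R : realType) (f : R -> R) (c l : R) :
  (forall x, derivable f x 1) -> is_derive c 1 f l ->
  (\forall x \near c, f c <= f x) \/ (\forall x \near c, f x <= f c) -> l = 0.
Proof.
move=> df Dl.
have ball_itv (P : R -> Prop) : (\forall x \near c, P x) ->
    exists2 r, 0 < r & forall t, t \in `]c - r, c + r[ -> P t.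
  move=> /nbhs_ballP[r r0 rP]; exists r => // t; rewrite in_itv /= => tr.
  by apply: rP; rewrite -ball_normE /ball_ /= distrC ltr_distl.
have itvc r : 0 < r -> c - r <= c + r /\ c \in `]c - r, c + r[.
  by move=> r0; rewrite in_itv /=; split; [lra|apply/andP; split; lra].
case=> /ball_itv[r r0 fr]; have [le_r c_in] := itvc r r0.
- have D0 := derive1_at_min le_r (fun t _ => df t) c_in fr.
  by rewrite -(derive_val (is_derive := Dl)) (derive_val (is_derive := D0)).
- have D0 := derive1_at_max le_r (fun t _ => df t) c_in fr.
  by rewrite -(derive_val (is_derive := Dl)) (derive_val (is_derive := D0)).
Qed.

Section Variation.
Context (R : realType) (q w : R) (I : set R) (a b : R) (L : R -> 'rV[R]_4 -> R).
Local Notation om := (omega0 q w).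
Context (PF : ProperFilter (within I om^')).

(** The direction in R^4 in which the arguments of L move when y moves along h;
    its last two components are h(a) = h(b) = 0. *)
Definition variation_dir (h : R -> R) (t : R) : 'rV[R]_4 :=
  h (q * t + w) *: delta_mx 0 0 + hahn q w I h t *: delta_mx 0 1.

Context (y h : R -> R).
Hypotheses (dy : derivable_within I y om) (dh : derivable_within I h om).
Hypotheses (h_a : h a = 0) (h_b : h b = 0).

Lemma var_alongE t e : var_along q w I a b L y h t e =
  L t (curly q w I a b y t + e *: variation_dir h t).
Proof.
rewrite /var_along /along; congr (L t _); apply/rowP => j.
have [dZ _] := derive_withinZ PF e dh.
rewrite !mxE hahnD// hahnZ// h_a h_b mulr0 !addr0.
by case: j => -[|[|[|[|k]]]] j4 //=; rewrite ?(mulr1, mulr0, addr0, add0r).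
Qed.

Lemma is_derive_var_along t (e : R) : classC1 (L t) ->
  is_derive e 1 (var_along q w I a b L y h t)
    ('D_(variation_dir h t) (L t)
       (curly q w I a b y t + e *: variation_dir h t)).
Proof.
move=> LC1; rewrite (funext (var_alongE t)); apply: derivable_along_line.
have [D _] := classC1_is_derive2 (curly q w I a b y t + e *: variation_dir h t)
  0 1 (h (q * t + w)) (hahn q w I h t) LC1.
exact: D.
Qed.

Lemma is_derive_var_along0 t : classC1 (L t) ->
  is_derive (0 : R) 1 (var_along q w I a b L y h t)
    (h (q * t + w) * along q w I a b (dL L 0) y t +
     hahn q w I h t * along q w I a b (dL L 1) y t).
Proof.
move=> LC1; have D := is_derive_var_along 0 LC1.
have [_ D2] := classC1_is_derive2 (curly q w I a b y t)
  0 1 (h (q * t + w)) (hahn q w I h t) LC1.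
by apply: is_derive_eq D _; rewrite scale0r addr0 D2.
Qed.

End Variation.

(** * The Euler-Lagrange equation along an orbit *)

Section EulerLagrange.
Context (R : realType) (q w : R) (I : set R) (a b alpha beta : R).
Context (L : R -> 'rV[R]_4 -> R) (y : R -> R).
Local Notation om := (omega0 q w).
Local Notation J := (functional q w I a b L).
Context (PF : ProperFilter (within I om^')).
Hypotheses (ab : a <= b).

Lemma near_admissible_variation (h : R -> R) (delta : R) : 0 < delta ->
  admissible q w I a b alpha beta y ->
  spaceY q w I a b 1 h -> h a = 0 -> h b = 0 ->
  \forall e \near (0 : R),
    admissible q w I a b alpha beta (fun t => y t + e * h t) /\
    normY q w I a b 1 (y \- (fun t => y t + e * h t)) < delta.
Proof.
move=> delta0 [Yy [ya yb]] Yh ha hb; near=> e; split.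
  split; first by apply: spaceY1D => //; exact: spaceY1Z.
  by rewrite ha hb mulr0 !addr0.
have -> : y \- (fun t => y t + e * h t) = (fun t => - e * h t).
  by apply/funext => t /=; ring.
apply: le_lt_trans (normYZ_le PF ab (- e) Yh) _; rewrite normrN.
set N := normY _ _ _ _ _ _ _.
apply: (@le_lt_trans _ _ (`|e| * (`|N| + 1))).
  by rewrite ler_wpM2l// (le_trans (ler_norm _))// lerDl.
rewrite -ltr_pdivlMr ?ltr_wpDl//; near: e.
by apply: (@nbhs0_lt R R^o); rewrite divr_gt0// ltr_wpDl.
Unshelve. all: by end_near.
Qed.

Hypothesis y_ext : local_minimizer q w I a b alpha beta J y \/
  local_maximizer q w I a b alpha beta J y.

Lemma local_extremum_variation (h : R -> R) :
  spaceY q w I a b 1 h -> h a = 0 -> h b = 0 ->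
  (\forall e \near (0 : R), J y <= J (fun t => y t + e * h t)) \/
  (\forall e \near (0 : R), J (fun t => y t + e * h t) <= J y).
Proof.
move=> Yh ha hb; case: y_ext => -[adm [delta delta0 Jy]]; [left|right].
- have := near_admissible_variation delta0 adm Yh ha hb.
  by apply: filterS => e [adm_e /Jy]; exact.
- have := near_admissible_variation delta0 adm Yh ha hb.
  by apply: filterS => e [adm_e /Jy]; exact.
Qed.

Hypotheses (hq : 0 < q < 1) (hI : is_interval I) (hI0 : I om).
Hypothesis H1 : forall t, I t -> classC1 (L t).
Hypothesis Hii : forall h, spaceY q w I a b 1 h ->
  \forall e \near (0 : R),
    qw_integrable q w a (fun t => var_along q w I a b L y h t e) /\
    qw_integrable q w b (fun t => var_along q w I a b L y h t e).

(** The end point x whose orbit is treated is a or b, and z is the other one;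
    sg is the sign of the integral up to x in the functional. *)
Lemma Euler_Lagrange_orbit (x z sg : R) :
  I x -> x != om ->
  (x = a /\ z = b) \/ (x = b /\ z = a) -> sg != 0 ->
  (forall f, qw_integral q w a b f =
     sg * (qw_integral0 q w x f - qw_integral0 q w z f)) ->
  (forall m n, qw_iter q w m x <> qw_iter q w n z) ->
  forall n, let t := qw_iter q w n x in
    along q w I a b (dL L 0) y t
    - hahn q w I (along q w I a b (dL L 1) y) t = 0.
Proof.
move=> Ix xom xz sg0 Jxz orb n t.
have iter_om k : qw_iter q w k x != om by rewrite qw_iter_eq_omega0.
have inj_x := qw_iter_inj hq xom.
have q0 : q != 0 by case/andP: hq => ? _; rewrite gt_eqF.
pose t1 := q * t + w; pose h : R -> R := point_mass t1.
have t1E : t1 = qw_iter q w n.+1 x by rewrite qw_iterS.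
have h0 s : s != t1 -> h s = 0 by rewrite /h /point_mass => /negbTE ->.
have hz k : qw_iter q w k z != t1 by apply/eqP; rewrite t1E => /esym/orb.
have [h_a h_b] : h a = 0 /\ h b = 0.
  have h_x : h x = 0.
    by apply: h0; rewrite -[x in x == _](qw_iter0 w hq) t1E (inj_eq inj_x).
  have h_z : h z = 0 by apply: h0; have := hz 0%N; rewrite qw_iter0.
  by case: xz => -[<- <-].
have Yh : spaceY q w I a b 1 h by apply: spaceY_point_mass; last exact: iter_om.
have hahn_h : hahn q w I h = fun s => point_mass t s / ((q - 1) * t + w)
    - point_mass t1 s / ((q - 1) * t1 + w).
  exact: hahn_point_mass (iter_om n).
have Yy : spaceY q w I a b 1 y by case: y_ext => -[[]].
have [dh _ _] := (spaceY1P _ _ _ _ _ _).1 Yh.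
have [dy _ _] := (spaceY1P _ _ _ _ _ _).1 Yy.
pose g s e := var_along q w I a b L y h s e.
have gE s e : s != t -> s != t1 -> g s e = g s 0.
  move=> st st1; rewrite /g !(var_alongE _ PF)//.
  have -> : variation_dir q w I h s = 0.
    rewrite /variation_dir hahn_h /point_mass (negbTE st) (negbTE st1).
    rewrite !mul0r subrr scale0r addr0 [h _]h0 ?scale0r//.
    by rewrite (inj_eq (addIr _)) (inj_eq (mulfI q0)).
  by rewrite !scaler0.
(* psi e is what survives of J (y + e h) - J y: two terms of the series at x. *)
pose psi e := sg * ((x * (1 - q) - w) *
  (q ^+ n * (g t e - g t 0) + q ^+ n.+1 * (g t1 e - g t1 0))).
have psiE : \forall e \near (0 : R), J (fun s => y s + e * h s) - J y = psi e.
  have y0 : y = (fun s => y s + 0 * h s).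
    by apply/funext => s; rewrite mul0r addr0.
  have int0 := nbhs_singleton (Hii Yh).
  near=> e.
  have inte : qw_integrable q w a (g ^~ e) /\ qw_integrable q w b (g ^~ e).
    by near: e; exact: Hii.
  have intx f : qw_integrable q w a f /\ qw_integrable q w b f ->
      qw_integrable q w x f.
    by case: xz => -[-> _] [].
  rewrite [in J y]y0 /functional !Jxz -mulrBr /psi; congr (_ * _).
  rewrite -[along _ _ _ _ _ _ _]/(g ^~ e) -[along _ _ _ _ _ _ _]/(g ^~ 0).
  rewrite (@qw_integral0_eq _ _ _ (g ^~ e) (g ^~ 0) z); last first.
    move=> k; apply: gE => //; apply/eqP => /esym; exact: orb.
  rewrite opprB addrA subrK t1E.
  apply: qw_integral0_subr_two; [exact: intx|exact: intx|].
  by move=> k kn kn1; apply: gE; rewrite ?t1E (inj_eq inj_x).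
pose c := sg * (x * (1 - q) - w) * q ^+ n.
have psi_derive (e l l1 : R) :
    is_derive e 1 (g t) l -> is_derive e 1 (g t1) l1 ->
    is_derive e 1 psi (c * (l + q * l1)).
  move=> Dt Dt1.
  have -> : psi =
      c \*: g t + (c * q) \*: g t1 + cst (- c * (g t 0 + q * g t1 0)).
    apply/funext => s; rewrite /psi /c exprS !fctE /=.
    by rewrite -![_ *: _]/(_ * _); ring.
  apply: is_derive_eq; rewrite addr0 -![_ *: _]/(_ * _); ring.
have It : I t by exact: qw_iter_in.
have It1 : I t1 by rewrite t1E; exact: qw_iter_in.
have psi_derivable (e : R) : derivable psi e 1.
  have Dt := is_derive_var_along PF dy dh h_a h_b e (H1 It).
  have Dt1 := is_derive_var_along PF dy dh h_a h_b e (H1 It1).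
  by have [] := psi_derive _ _ _ Dt Dt1.
have Dt := is_derive_var_along0 PF dy dh h_a h_b (H1 It).
have Dt1 := is_derive_var_along0 PF dy dh h_a h_b (H1 It1).
have psi0 : psi 0 = 0 by rewrite /psi !subrr !mulr0 addr0 mulr0 mulr0.
have := local_extremum_derive0 psi_derivable (psi_derive _ _ _ Dt Dt1).
have psi_ext : (\forall e \near 0, psi 0 <= psi e) \/
    (\forall e \near 0, psi e <= psi 0).
  rewrite psi0.
  case: (local_extremum_variation Yh h_a h_b) => Jle; [left|right].
  - by near=> e; rewrite -(near psiE e)// subr_ge0; near: e.
  - by near=> e; rewrite -(near psiE e)// subr_le0; near: e.
move=> /(_ psi_ext)/eqP.
(* Up to sg, c is a power of q times the length factor of the integral up to x,
   which is nonzero as x is not omega_0. *)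
have c0 : c != 0.
  rewrite /c !mulf_neq0 ?expf_neq0//.
  have -> : x * (1 - q) - w = - ((q - 1) * x + w) by ring.
  by rewrite oppr_eq0 hahn_denom_eq0.
have tt1 : t != t1 by rewrite t1E [t == _](inj_eq inj_x n n.+1) ltn_eqF.
have -> : h (q * t + w) = 1 by rewrite /h /point_mass eqxx.
have -> : h (q * t1 + w) = 0.
  by apply: h0; rewrite t1E -qw_iterS// (inj_eq inj_x n.+2 n.+1) gtn_eqF.
rewrite mulf_eq0 (negbTE c0) /= hahn_h /point_mass !eqxx (negbTE tt1).
rewrite [t1 == t]eq_sym (negbTE tt1).
have m0 : (q - 1) * t + w != 0 by rewrite hahn_denom_eq0 // iter_om.
(* The Hahn steps at t and t1 have ratio q, so the powers q^n and q^(n+1) of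
   the series recombine the two terms in d_3 L into a Hahn quotient. *)
have -> : (q - 1) * t1 + w = q * ((q - 1) * t + w) by rewrite /t1; ring.
rewrite [hahn _ _ _ (along _ _ _ _ _ _ _) _]/hahn (negbTE (iter_om n)) -/t1.
move=> /eqP EL; rewrite -[RHS]EL /= mulr1n mulr0n.
field.
by rewrite q0 m0.
Unshelve. all: by end_near.
Qed.

End EulerLagrange.

(** * The theorem *)

Theorem theorem3p4 (R : realType) (q w : R) (I : set R) (a b alpha beta : R)
    (L : R -> 'rV[R]_4 -> R) (ytilde : R -> R)
    (hq : 0 < q < 1) (hw : 0 <= w)
    (hI : is_interval I) (hI0 : I (omega0 q w))
    (ha : I a) (hb : I b) (hab : a < b)
    (horb : disjoint_orbits q w a b)
    (H1 : forall t, I t -> classC1 (L t))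
    (H2 : forall y, spaceY q w I a b 1 y ->
       continuous_within I (along q w I a b L y) (omega0 q w))
    (H3 : forall y, spaceY q w I a b 1 y -> forall j : 'I_4,
       spaceY q w I a b 1 (along q w I a b (dL L j) y))
    (Hi : forall y h, spaceY q w I a b 1 y -> spaceY q w I a b 1 h ->
       unif_derivable0 (qw_interval q w a b) (var_along q w I a b L y h))
    (Hii : forall y h, spaceY q w I a b 1 y -> spaceY q w I a b 1 h ->
       \forall e \near (0 : R),
         qw_integrable q w a (fun t => var_along q w I a b L y h t e) /\
         qw_integrable q w b (fun t => var_along q w I a b L y h t e))
    (Hiii : forall y h, spaceY q w I a b 1 y -> spaceY q w I a b 1 h ->
       qw_integrable q w a (fun t => derive1 (var_along q w I a b L y h t) 0) /\
       qw_integrable q w b (fun t => derive1 (var_along q w I a b L y h t) 0)) :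
  local_minimizer q w I a b alpha beta (functional q w I a b L) ytilde \/
  local_maximizer q w I a b alpha beta (functional q w I a b L) ytilde ->
  forall t, qw_interval q w a b t ->
    along q w I a b (dL L 0) ytilde t
    - hahn q w I (along q w I a b (dL L 1) ytilde) t = 0.
Proof.
move=> y_ext.
have Yy : spaceY q w I a b 1 ytilde by case: y_ext => -[[]].
have Hiiy h : spaceY q w I a b 1 h -> \forall e \near (0 : R),
    qw_integrable q w a (fun t => var_along q w I a b L ytilde h t e) /\
    qw_integrable q w b (fun t => var_along q w I a b L ytilde h t e).
  exact: Hii.
pose EL t := along q w I a b (dL L 0) ytilde t
  - hahn q w I (along q w I a b (dL L 1) ytilde) t.
have EL_a : a != omega0 q w -> forall n, EL (qw_iter q w n a) = 0.
  move=> aom; have PF := within_dnbhs_omega0_proper hq hI hI0 ha aom.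
  have := Euler_Lagrange_orbit PF (ltW hab) y_ext hq hI hI0 H1 Hiiy (x := a)
    (z := b) (sg := -1) ha aom; apply => //.
  - by left.
  - by move=> f; rewrite mulN1r opprB.
have EL_b : b != omega0 q w -> forall n, EL (qw_iter q w n b) = 0.
  move=> bom; have PF := within_dnbhs_omega0_proper hq hI hI0 hb bom.
  have := Euler_Lagrange_orbit PF (ltW hab) y_ext hq hI hI0 H1 Hiiy (x := b)
    (z := a) (sg := 1) hb bom; apply => //.
  - by right.
  - by move=> f; rewrite mul1r.
  - by move=> m n /esym; exact: horb.
(* Since a < b, one of them differs from omega_0, and its orbit tends to it. *)
have EL_om : EL (omega0 q w) = 0.
  have [x [Ix EL_x]] : exists x, I x /\ forall n, EL (qw_iter q w n x) = 0.
    have [aom|aom] := eqVneq a (omega0 q w); last first.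
      by exists a; split=> //; exact: EL_a.
    by exists b; split=> //; apply: EL_b; rewrite gt_eqF// -aom.
  have [_ [_ c0] _] := (spaceY1P _ _ _ _ _ _).1 (H3 _ Yy 0).
  have [_ _ [_ c1]] := (spaceY1P _ _ _ _ _ _).1 (H3 _ Yy 1).
  have EL_cvg : EL t @[t --> within I (nbhs (omega0 q w))] --> EL (omega0 q w).
    exact: cvgB.
  have := cvg_comp _ _ (qw_iter_cvg_within hq hI hI0 Ix) EL_cvg.
  have -> : EL \o (fun n => qw_iter q w n x) = cst 0.
    by apply/funext => n; exact: EL_x.
  by move=> /(cvg_lim (@Rhausdorff R)); rewrite lim_cst.
(* The orbit of omega_0 is omega_0 itself. *)
have orbit x : (x != omega0 q w -> forall n, EL (qw_iter q w n x) = 0) ->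
    forall n, EL (qw_iter q w n x) = 0.
  move=> EL_x n; have [xom|] := eqVneq x (omega0 q w); last by move/EL_x.
  by rewrite (eqP (_ : qw_iter q w n x == omega0 q w)) ?qw_iter_eq_omega0// xom.
move=> t [[[n ->]|[n ->]]|->]; [exact: orbit|exact: orbit|exact: EL_om].
Qed.
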